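(* Let $G$ be a finite simple graph with $n$ vertices and $m$ edges, let $k \in \{1,\ldots,n\}$, and let $\|L(G)\|_{(k)}$ denote the sum of the $k$ largest eigenvalues of the Laplacian $L(G)$. Then $$\|L(G)\|_{(k)} - \left(m + \binom{k+1}{2}\right) \le 2^{3/4} n^{1/4}\sqrt{k(n-k)} \le 2^{3/4} n^{3/4}\sqrt{k}.$$ Moreover, if $t = t(G) := \max_{\emptyset \ne S \subseteq V(G)} \rho(G[S])/|S|$, then $$\|L(G)\|_{(k)} \le m + \binom{k+1}{2} + \frac{2^{3/2}}{\sqrt{1-t}}\, n,$$ and if $G$ is bipartite then $$\|L(G)\|_{(k)} \le m + \binom{k+1}{2} + 4n.$$
   Context: $L(G) = D(G) - A(G)$ is the Laplacian ($A$ adjacency matrix, $D$ diagonal degree matrix). $G[S]$ is the induced subgraph on $S$ and $\rho(H)$ is the largest eigenvalue of the adjacency matrix of $H$; $t(G) \in [0,1)$ is called the maximum subgraph spectral density. *)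

(* Defs.v *)
From HB Require Import structures.
From mathcomp Require Import all_boot all_order all_algebra.
From mathcomp Require Import reals exp.
From mathcomp Require Import polyrcf.

Set Implicit Arguments.
Unset Strict Implicit.
Unset Printing Implicit Defensive.

Import Order.TTheory GRing.Theory Num.Theory.
Local Open Scope ring_scope.

Record sgraph := SGraph {
  vertex :> finType;
  adj : rel vertex;
  adj_sym : symmetric adj;
  adj_irr : irreflexive adj }.

Arguments adj {s} x y.

Definition edges (G : sgraph) : {set {set G}} :=
  [set E | [exists x : G, exists y : G, adj x y && (E == [set x; y])]].

Definition degree (G : sgraph) (x : G) : nat := #|[set y | adj x y]|.

Definition bipartite (G : sgraph) : Prop :=
  exists A : {set G}, forall x y : G, adj x y -> (x \in A) != (y \in A).

Section Induced.
Variables (G : sgraph) (S : {set G}).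

Definition induced_adj : rel {x : G | x \in S} :=
  fun x y => adj (val x) (val y).

Lemma induced_sym : symmetric induced_adj.
Proof. by move=> x y; apply: adj_sym. Qed.

Lemma induced_irr : irreflexive induced_adj.
Proof. by move=> x; apply: adj_irr. Qed.

Definition induced : sgraph := SGraph induced_sym induced_irr.
End Induced.

Section Spectrum.
Variable R : realType.

(* The eigenvalues of A in R, repeated according to their algebraic
   multiplicity and in nonincreasing order. When A is symmetric all its
   eigenvalues are in R, so this list has n items. *)
Definition eigenvalues n (A : 'M[R]_n) : seq R :=
  sort >=%R (flatten [seq nseq (mup x (char_poly A)) x
                     | x <- rootsR (char_poly A)]).

(* Validates [eigenvalues]: it is the list of the roots of the
   characteristic polynomial whenever the latter splits over R. *)
Lemma eigenvaluesE n (A : 'M[R]_n) (s : seq R) :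
  sorted >=%R s -> char_poly A = \prod_(x <- s) ('X - x%:P) ->
  eigenvalues A = s.
Proof.
move=> s_sorted As; have pN0 : char_poly A != 0.
  by rewrite monic_neq0 ?char_poly_monic.
have ge_trans : transitive (>=%R : rel R).
  by move=> x y z /= yx zy; apply: le_trans zy yx.
have ge_anti : antisymmetric (>=%R : rel R).
  by move=> x y; rewrite andbC; exact: le_anti.
apply: (sorted_eq ge_trans ge_anti) => //.
  by apply: sort_sorted => x y; exact: le_total.
rewrite perm_sort; apply/allP => x _ /=; apply/eqP.
rewrite -(mu_prod_XsubC x s) -As count_flatten -map_comp sumnE big_map.
rewrite (eq_bigr (fun y => if y == x then mup x (char_poly A) else 0%N));
  last first.
  by move=> y _ /=; rewrite count_nseq /=; case: eqP => [->|_];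
    rewrite ?mul1n ?mul0n.
rewrite -big_mkcond /= big_const_seq iter_addn_0.
rewrite count_uniq_mem ?uniq_roots // -roots_on_rootsR // in_itv /=.
by case: (boolP (root _ x)) => [|/mupNroot ->]; rewrite ?muln1 ?muln0.
Qed.

Definition sum_largest n (A : 'M[R]_n) (k : nat) : R :=
  \sum_(i < k) (eigenvalues A)`_i.

Definition adjacency (G : sgraph) : 'M[R]_#|G| :=
  \matrix_(i, j) (adj (enum_val i) (enum_val j))%:R.

Definition degree_mx (G : sgraph) : 'M[R]_#|G| :=
  diag_mx (\row_i (degree (enum_val i))%:R).

Definition laplacian (G : sgraph) : 'M[R]_#|G| := degree_mx G - adjacency G.

Definition rho (G : sgraph) : R := (eigenvalues (adjacency G))`_0.

(* The seed 0 does not affect the maximum when G is nonempty: adjacency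
   matrices have trace 0, so every value in the range is nonnegative. *)
Definition max_subgraph_density (G : sgraph) : R :=
  \big[Num.max/0]_(S : {set G} | S != set0)
     (rho (induced S) / #|S|%:R).

End Spectrum.

(* Main.v *)
(** By spectral decomposition the sum of the [k] largest eigenvalues of [L] is
    [tr (L P)] for a symmetric [P] with [0 <= P <= 1] and [tr P = k]. With
    [p_u := P u u] and [q_u := 1 - p_u], the identity
    [p_u + p_v - 1 = p_u p_v - q_u q_v] gives
      [tr (L P) - m - k (k + 1) / 2 = - (k + sum_u p_u^2) / 2
         - sum_(uv non-edge) p_u p_v - sum_(uv edge) (q_u q_v + 2 P_uv)].
    Only [- 2 P_uv] can be positive. Since [P^2 <= P], the off-diagonal entries
    of row [u] have squares summing to at most [p_u q_u]; hence, by AM-GM, on an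
    edge with an end where [p <= 1/2] the gain [q_u q_v] absorbs [- 2 P_uv] up
    to [P_uv^2 / q], which sums to [O(k)]. On the block where [p > 1/2] the sum
    of all entries of [P] is nonnegative, so the sum of [- P_uv] over edges is
    at most that of [P_uv] over non-edges plus [O(k)], and there the gain is
    [p_u p_v]. The error is thus at most [9 k / 4]; passing to the complement
    graph and [1 - P] it is also at most [13 (n - k) / 4]. These two bounds
    imply all three estimates, except the first one for [n <= 6], where
    [tr (L P) <= tr L] completes the argument. *)

Require Import Defs.
From mathcomp Require Import all_boot all_order all_algebra.
From mathcomp Require Import reals exp polyrcf complex spectral sesquilinear.
From mathcomp Require Import ring lra.
Import Order.TTheory GRing.Theory Num.Theory.

Set Implicit Arguments.
Unset Strict Implicit.
Unset Printing Implicit Defensive.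

Local Open Scope ring_scope.

(** * Symmetric matrices between 0 and 1, and linear bounds on their defect *)

Section Contraction.
Variables (R : realFieldType) (T : finType).
Implicit Types (P : T -> T -> R) (e : rel T).

Definition contraction P :=
  (forall u v, P u v = P v u) /\
  forall x : T -> R,
    0 <= \sum_u \sum_v x u * P u v * x v <= \sum_u x u ^+ 2.

Definition ccompl P : T -> T -> R := fun u v => (u == v)%:R - P u v.

Lemma sum_delta (x : T -> R) u : \sum_v (u == v)%:R * x v = x u.
Proof.
rewrite (bigD1 u) //= eqxx mul1r big1 ?addr0 // => v.
by rewrite eq_sym => /negbTE ->; rewrite mul0r.
Qed.

Lemma ccompl_contraction P : contraction P -> contraction (ccompl P).
Proof.
move=> [sP qP]; split=> [u v|x]; first by rewrite /ccompl sP eq_sym.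
have -> : \sum_u \sum_v x u * ccompl P u v * x v =
    \sum_u x u ^+ 2 - \sum_u \sum_v x u * P u v * x v.
  rewrite -sumrB; apply: eq_bigr => u _.
  have -> : x u ^+ 2 = \sum_v x u * ((u == v)%:R * x v).
    by rewrite -mulr_sumr sum_delta expr2.
  rewrite -sumrB; apply: eq_bigr => v _.
  by rewrite /ccompl; ring.
by have := qP x; lra.
Qed.

(* The form of [P] at [e_u - P e_u] is nonnegative, which gives [P^2 <= P]. *)
Lemma contraction_row P u : contraction P -> \sum_v P u v ^+ 2 <= P u u.
Proof.
move=> [sP qP].
have /andP[/= + _] := qP (fun v => (u == v)%:R - P u v).
(* The upper bound at row [u] gives [yPy <= y2]; with [0 <= P u u - 2 y2 + yPy] this leaves
   [y2 <= P u u]. *)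
have /andP[/= _] := qP (fun v => P u v).
set y2 := \sum_v P u v ^+ 2; set yPy := \sum_a \sum_b _ => h1.
have -> : \sum_a \sum_b ((u == a)%:R - P u a) * P a b * ((u == b)%:R - P u b) =
    P u u - y2 *+ 2 + yPy.
  have -> : P u u - y2 *+ 2 + yPy = P u u - y2 - y2 + yPy by rewrite mulr2n; ring.
  have {1}-> : P u u = \sum_a (u == a)%:R * \sum_b (u == b)%:R * P a b.
    by rewrite !sum_delta.
  have {1}-> : y2 = \sum_a (u == a)%:R * \sum_b P u b * P a b.
    by rewrite sum_delta; apply: eq_bigr => b _; rewrite expr2.
  have -> : y2 = \sum_a P u a * \sum_b (u == b)%:R * P a b.
    by apply: eq_bigr => a _; rewrite sum_delta expr2 (sP u a).
  rewrite -!sumrB -big_split /=; apply: eq_bigr => a _.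
  rewrite !mulr_sumr -!sumrB -big_split /=; apply: eq_bigr => b _; ring.
by rewrite mulr2n; lra.
Qed.

Lemma contraction_offdiag P u :
  contraction P -> \sum_(v | v != u) P u v ^+ 2 <= P u u * (1 - P u u).
Proof.
move=> cP; have := contraction_row u cP; rewrite (bigD1 u) //=; nra.
Qed.

Lemma contraction_offdiag1 P u v :
  contraction P -> v != u -> P u v ^+ 2 <= P u u * (1 - P u u).
Proof.
move=> cP vu; apply: le_trans (contraction_offdiag u cP).
by rewrite (bigD1 v) //= lerDl; apply: sumr_ge0 => w _; exact: sqr_ge0.
Qed.

Lemma contraction_diag P u : contraction P -> 0 <= P u u <= 1.
Proof.
move=> [_ qP]; have := qP (fun v => (u == v)%:R).
have -> : \sum_a \sum_b (u == a)%:R * P a b * (u == b)%:R = P u u.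
  under eq_bigr do under eq_bigr do rewrite -mulrA.
  under eq_bigr do rewrite -mulr_sumr.
  by rewrite sum_delta; under eq_bigr do rewrite mulrC; rewrite sum_delta.
by under eq_bigr do rewrite expr2; rewrite sum_delta eqxx.
Qed.

Lemma contraction_pair P u v :
  contraction P -> u != v -> P u u + P v v - P u v *+ 2 <= 2.
Proof.
move=> [sP qP] uv; have /andP[_] := qP (fun w => (u == w)%:R - (v == w)%:R).
have -> : \sum_w ((u == w)%:R - (v == w)%:R) ^+ 2 = 2 :> R.
  have E w : ((u == w)%:R - (v == w)%:R) ^+ 2
      = (u == w)%:R * 1 + (v == w)%:R * 1 :> R.
    case: eqVneq => [<-|_]; last by case: (v == w) => /=; ring.
    by rewrite eq_sym (negbTE uv) /=; ring.
  under eq_bigr do rewrite E.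
  by rewrite big_split /= !sum_delta; ring.
have -> : \sum_a \sum_b ((u == a)%:R - (v == a)%:R) * P a b *
     ((u == b)%:R - (v == b)%:R) = P u u + P v v - P u v *+ 2.
  under eq_bigr do under eq_bigr do rewrite -mulrA.
  under eq_bigr do rewrite -mulr_sumr mulrBl.
  rewrite sumrB !sum_delta.
  have E w : \sum_b P w b * ((u == b)%:R - (v == b)%:R) = P w u - P w v.
    rewrite -(sum_delta (P w) u) -(sum_delta (P w) v) -sumrB.
    by apply: eq_bigr => b _; ring.
  by rewrite !E (sP v u) mulr2n; ring.
by [].
Qed.

(* Twice the Brouwer defect of [P] is the sum of these terms over all [u, v]. *)
Definition defect e P u v : R :=
  if u == v then - (P u u + P u u ^+ 2)
  else if e u v then - ((1 - P u u) * (1 - P v v) + P u v *+ 2)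
  else - (P u u * P v v).

(** Complementing both the graph and [P] swaps [p] with [q] and edges with non-edges; the leftover
    terms are linear in [P]. *)
Lemma defect_compl e P u v :
  defect e P u v = defect (fun a b => ~~ e a b) (ccompl P) u v
    + ccompl P u v *+ 2 - (u == v)%:R * (P u u *+ 2).
Proof.
rewrite /defect /ccompl !eqxx; case: eqVneq => [<-|_] /=; rewrite ?mulr2n; first ring.
by case: (e u v) => /=; ring.
Qed.

Definition heavy P u : bool := ~~ (P u u <= 1 / 2).

(** The weight with which [P u v ^+ 2] is charged to its end [u]. By [contraction_offdiag] the total
    at [u] is at most [P u u], doubled if [u] is heavy. At [P u u = 1] the quotient is 0, but then
    the off-diagonal row vanishes too. *)
Definition charge P u : R := (if heavy P u then 2 else 1) / (1 - P u u).

(** The charges pay for [- 2 P u v] unless both ends are heavy. There this term stays in the bound,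
    for non-edges too, so that summation produces the nonnegative form of [P] at the indicator of
    the heavy set. *)
Lemma pair_defect_le e P u v : contraction P -> u != v ->
  defect e P u v <= - ((heavy P u)%:R * P u v * (heavy P v)%:R) *+ 2
    + P u v ^+ 2 * charge P u + P u v ^+ 2 * charge P v.
Proof.
move=> cP uv.
have hu := contraction_offdiag1 (u := u) (v := v) cP; rewrite eq_sym uv in hu.
have hv := contraction_offdiag1 (u := v) (v := u) cP uv.
have {}hu := hu isT; rewrite (cP.1 v u) in hv.
have pu := contraction_diag u cP; have pv := contraction_diag v cP.
rewrite /defect (negbTE uv) /charge /heavy.
move: (P u u) (P v v) (P u v) pu pv hu hv => p p' x.
move=> /andP[p0 p1] /andP[p0' p1'] hx hx'.
(* For [p = 1] the bound [hx] forces [x = 0], so [y * (1 - p) = x ^+ 2] survives the division by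
   zero. *)
have [y [y0 yq ->]] : exists y, [/\ 0 <= y, y * (1 - p) = x ^+ 2 &
    forall a, x ^+ 2 * (a / (1 - p)) = a * y].
  exists (x ^+ 2 / (1 - p)); split; last by move=> a; ring.
    by rewrite divr_ge0 ?sqr_ge0 ?subr_ge0.
  have [q0|q0] := eqVneq (1 - p) 0; last by rewrite divfK.
  by rewrite q0 mulr0; move: hx; rewrite q0 mulr0; have := sqr_ge0 x; lra.
have [y' [y0' yq' ->]] : exists y, [/\ 0 <= y, y * (1 - p') = x ^+ 2 &
    forall a, x ^+ 2 * (a / (1 - p')) = a * y].
  exists (x ^+ 2 / (1 - p')); split; last by move=> a; ring.
    by rewrite divr_ge0 ?sqr_ge0 ?subr_ge0.
  have [q0|q0] := eqVneq (1 - p') 0; last by rewrite divfK.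
  by rewrite q0 mulr0; move: hx'; rewrite q0 mulr0; have := sqr_ge0 x; lra.
(* An edge with a light end: [a] comes from that end, [b] and [w] from the other. Multiplication by
   [b] reduces the claim to [0 <= (a - 1/2) b^2 + (b + 2 t)^2 / 2]. *)
have light_edge (a b z w t : R) : 1 / 2 <= a -> 0 <= b -> 0 <= z -> 0 <= w ->
    t ^+ 2 <= b -> w * b = t ^+ 2 -> - (a * b + t *+ 2) <= z + 2 * w.
  move=> a2 b0 z0 w0 tb wb; rewrite mulr2n.
  have [b00|b00] := eqVneq b 0.
    suff t0 : t = 0 by rewrite t0 b00; lra.
    by apply/eqP; rewrite -sqrf_eq0; apply/eqP; have := sqr_ge0 t; lra.
  have {b00}b0' : 0 < b by rewrite lt_def b00.
  suff : 0 <= (a * b + (t + t) + 2 * w) * b by rewrite pmulr_lge0 //; lra.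
  have -> : (a * b + (t + t) + 2 * w) * b =
      a * b ^+ 2 + (t + t) * b + 2 * (w * b) by ring.
  have -> : a * b ^+ 2 + (t + t) * b + 2 * (w * b) =
      (a - 1 / 2) * b ^+ 2 + 1 / 2 * (b + (t + t)) ^+ 2 by rewrite wb; field.
  by rewrite addr_ge0 // mulr_ge0 ?sqr_ge0 //; lra.
have pp := mulr_ge0 p0 p0'.
case: (leP p (1/2)) => hp; case: (leP p' (1/2)) => hp' /=;
  rewrite ?(mul0r, mulr0, mul1r, mulr1, oppr0, mul0rn, add0r).
- case: (e u v); last by lra.
  rewrite mulr2n.
  (* Two light ends: completing the square leaves [x^2 ((1 - p) + (1 - p') - 1)], where [1 - p] and
     [1 - p'] are at least 1/2. *)
  have qq : 0 < (1 - p) * (1 - p') by apply: mulr_gt0; lra.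
  suff : 0 <= ((1 - p) * (1 - p') + (x + x) + y + y') * ((1 - p) * (1 - p')).
    by rewrite pmulr_lge0 //; lra.
  have -> : ((1 - p) * (1 - p') + (x + x) + y + y') * ((1 - p) * (1 - p')) =
    ((1 - p) * (1 - p') + x) ^+ 2 + (y * (1 - p)) * (1 - p')
     + (y' * (1 - p')) * (1 - p) - x ^+ 2 by ring.
  rewrite yq yq'.
  have := sqr_ge0 ((1 - p) * (1 - p') + x); have := sqr_ge0 x; nra.
- case: (e u v); last by lra.
  by apply: light_edge => //; [lra|lra|nra].
- case: (e u v); last by lra.
  rewrite [(1 - p) * _]mulrC [2 * y + _]addrC.
  by apply: light_edge => //; [lra|lra|nra].
(* Two heavy ends: [1 - p < 1/2] makes [y] at least [2 x^2]. A non-edge then needs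
   [2 x <= p p' + 8 x^2], where [p p' > 1/4]. *)
- have Y : 4 * x ^+ 2 <= 2 * y by rewrite -yq; nra.
  have Y' : 4 * x ^+ 2 <= 2 * y' by rewrite -yq'; nra.
  have qq : 0 <= (1 - p) * (1 - p') by apply: mulr_ge0; lra.
  rewrite !mulr2n; case: (e u v); first by lra.
  have := sqr_ge0 (x * 8 - 1); nra.
Qed.

Lemma defect_le e P : contraction P ->
  \sum_u \sum_v defect e P u v <= 9 / 2 * \sum_u P u u.
Proof.
move=> cP.
pose s u : R := (heavy P u)%:R.
pose off u := \sum_(v | v != u) P u v ^+ 2.
(* Every ordered pair charges both ends, hence two equal charge sums. The term [P u u *+ 2 * s u]
   offsets the diagonal of the last sum. *)
have step : \sum_u \sum_v defect e P u v <=
    \sum_u (P u u *+ 2 * s u - (P u u + P u u ^+ 2))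
    + \sum_u off u * charge P u + \sum_u off u * charge P u
    - \sum_u (\sum_v s u * P u v * s v) *+ 2.
  have E2 : \sum_u off u * charge P u =
      \sum_u \sum_(v | v != u) P u v ^+ 2 * charge P v.
    have E3 (F : T -> T -> R) : \sum_u \sum_(v | v != u) F u v
        = \sum_u \sum_(v | v != u) F v u.
      under eq_bigr do rewrite big_mkcond.
      rewrite exchange_big /=; apply: eq_bigr => u _.
      by rewrite [RHS]big_mkcond /=; apply: eq_bigr => v _; rewrite eq_sym.
    rewrite E3; apply: eq_bigr => u _; rewrite mulr_suml.
    by apply: eq_bigr => v _; rewrite (cP.1 v u).
  rewrite {2}E2 -!big_split -sumrB /=.
  apply: ler_sum => u _; rewrite (bigD1 u) //= [\sum_v s u * _ * _](bigD1 u) //=.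
  have -> : defect e P u u = - (P u u + P u u ^+ 2) by rewrite /defect eqxx.
  have ss : s u * P u u * s u = s u * P u u.
    by rewrite mulrAC -expr2 /s; case: heavy; rewrite /= ?expr1n ?expr0n.
  have : \sum_(v | v != u) defect e P u v <=
      \sum_(v | v != u) (- (s u * P u v * s v) *+ 2
         + P u v ^+ 2 * charge P u + P u v ^+ 2 * charge P v).
    by apply: ler_sum => v vu; apply: pair_defect_le => //; rewrite eq_sym.
  rewrite !big_split /= sumrN -mulr_suml -/(off u) ss !mulr2n; lra.
have /andP[+ _] := cP.2 s.
(* A light vertex costs at most [2 p - p - p^2 <= p]. A heavy one costs at most
   [2 p + 4 p - p - p^2], and [p^2 >= p / 2] there: hence 9/2. *)
have per u : P u u *+ 2 * s u - (P u u + P u u ^+ 2)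
    + off u * charge P u + off u * charge P u <= 9 / 2 * P u u.
  have := contraction_offdiag u cP; rewrite -/(off u).
  have off0 : 0 <= off u by apply: sumr_ge0 => v _; exact: sqr_ge0.
  have := contraction_diag u cP; rewrite /charge /s.
  move: (off u) off0 => z z0 /andP[p0 p1] hz.
  have [y [y0 yp ->]] : exists y, [/\ 0 <= y, y <= P u u &
     forall a, z * (a / (1 - P u u)) = a * y].
    exists (z / (1 - P u u)); split; last by move=> a; ring.
      by rewrite divr_ge0 ?subr_ge0.
    have [q0|q0] := eqVneq (1 - P u u) 0; first by rewrite q0 invr0 mulr0.
    by rewrite ler_pdivrMr // lt_def q0 subr_ge0.
  rewrite /heavy; move: (P u u) p0 yp => p p0 yp.
  case: (leP p (1 / 2)) => h /=; rewrite ?mulr0 ?mulr1.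
    by have := sqr_ge0 p; lra.
  have : p * (1 / 2) <= p ^+ 2 by rewrite expr2 ler_wpM2l // ltW.
  lra.
rewrite mulr_sumr => sPs; apply: le_trans step _.
apply: le_trans (ler_sum (index_enum T) (fun u (_ : true) => per u)).
by rewrite !big_split /= !sumrN ?sumrMnl; lra.
Qed.

(** The complement contributes 9/2 by [defect_le]. The form of [ccompl P] at the all-ones vector is
    at most [#|T|], so the linear terms add 2. *)
Lemma defect_compl_le e P : contraction P ->
  \sum_u \sum_v defect e P u v <= 13 / 2 * (#|T|%:R - \sum_u P u u).
Proof.
move=> cP; have cQ := ccompl_contraction cP.
have trQ : \sum_u ccompl P u u = #|T|%:R - \sum_u P u u.
  rewrite sumrB; congr (_ - _).
  by under eq_bigr do rewrite eqxx; rewrite sumr_const.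
have oneQ : \sum_u \sum_v ccompl P u v <= #|T|%:R.
  have /andP[_] := cQ.2 (fun=> 1).
  under eq_bigr do under eq_bigr do rewrite mul1r mulr1.
  by under [X in _ <= X]eq_bigr do rewrite expr1n; rewrite sumr_const.
have := defect_le (fun a b => ~~ e a b) cQ; rewrite trQ.
have -> : \sum_u \sum_v defect e P u v =
   \sum_u \sum_v defect (fun a b => ~~ e a b) (ccompl P) u v
   + (\sum_u \sum_v ccompl P u v) *+ 2 - (\sum_u P u u) *+ 2.
  rewrite -!sumrMnl -big_split -sumrB /=; apply: eq_bigr => u _.
  have -> : P u u *+ 2 = \sum_v (u == v)%:R * (P u u *+ 2) by rewrite sum_delta.
  rewrite -sumrMnl -big_split -sumrB /=.
  by apply: eq_bigr => v _; rewrite defect_compl.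
lra.
Qed.

End Contraction.

(** * Spectral decomposition of real symmetric matrices *)

Lemma char_poly_similar (F : fieldType) n (U A B : 'M[F]_n) :
  U \in unitmx -> A = invmx U *m B *m U -> char_poly A = char_poly B.
Proof.
move=> Uu ->; rewrite /char_poly.
have -> : char_poly_mx (invmx U *m B *m U) =
    map_mx polyC (invmx U) *m char_poly_mx B *m map_mx polyC U.
  rewrite /char_poly_mx mulmxBr mulmxBl !map_mxM; congr (_ - _).
  by rewrite -scalemx1 -scalemxAr mulmx1 -scalemxAl -map_mxM mulVmx // map_mx1.
rewrite !det_mulmx mulrAC -det_mulmx -map_mxM mulVmx // map_mx1 det1.
by rewrite mul1r.
Qed.

Section Spectral.
Variable R : realType.

Lemma Re_sum (I : Type) (r : seq I) (P : pred I) (F : I -> R[i]) :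
  complex.Re (\sum_(i <- r | P i) F i) = \sum_(i <- r | P i) complex.Re (F i).
Proof. by apply: big_morph => // -[a b] [c d]. Qed.

Lemma Re_mul_conj (x y : R[i]) (a : R) :
  complex.Re (x * real_complex R a * Num.conj y) =
  a * (complex.Re x * complex.Re y + complex.Im x * complex.Im y).
Proof. by case: x y => [x1 x2] [y1 y2] /=; ring. Qed.

(* [X] and [Y] are the real and imaginary parts of a unitary matrix
   diagonalizing [A]. *)
Lemma symmetric_spectral n (A : 'M[R]_n) : A^T = A ->
  exists (d : 'I_n -> R) (X Y : 'M[R]_n),
  [/\ char_poly A = \prod_i ('X - (d i)%:P),
      forall j l, \sum_i (X i j * X i l + Y i j * Y i l) = (j == l)%:R,
      forall i, \sum_j (X i j ^+ 2 + Y i j ^+ 2) = 1 &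
      forall i, \sum_j \sum_l A j l * (X i j * X i l + Y i j * Y i l) = d i].
Proof.
move=> As; pose C := map_mx (real_complex R) A : 'M[R[i]]_n.
have Ch : C \is hermsymmx.
  apply/is_hermitianmxP; rewrite expr0 scale1r; apply/matrixP => i j.
  rewrite !mxE -[in LHS]As mxE; apply/esym/CrealP.
  by apply/complex_realP; eexists.
have /hermitian_normalmx /orthomx_spectralP CE := Ch.
have dr := hermitian_spectral_diag_real Ch.
have Uunitary := spectral_unitarymx C.
have UiE := invmx_unitary Uunitary.
have Uu := spectral_unit C.
set U := spectralmx C in CE UiE Uunitary Uu.
set D := spectral_diag C in CE dr.
have DE i : D 0 i = (complex.Re (D 0 i))%:C%C.
  by rewrite RRe_real //; apply: (mxOverP dr).
exists (fun i => complex.Re (D 0 i)), (map_mx (@complex.Re R) U),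
  (map_mx (@complex.Im R) U); split.
- apply: (map_poly_inj (real_complex R)); rewrite map_char_poly -/C.
  rewrite (char_poly_similar Uu CE) char_poly_trig; last first.
    by apply/is_trig_mxP => i j ij; rewrite !mxE -val_eqE /= (ltn_eqF ij).
  rewrite rmorph_prod /=; apply: eq_bigr => i _.
  by rewrite rmorphB /= map_polyX map_polyC /= -DE !mxE eqxx mulr1n.
(* The last three claims are real parts of entries of [U^* U = 1], [U U^* = 1] and [U C U^* = D]. *)
- move=> j l; have := mulVmx Uu; rewrite UiE => /matrixP /(_ l j).
  rewrite !mxE => /(congr1 (@complex.Re R)); rewrite Re_sum.
  have -> : complex.Re ((l == j)%:R : R[i]) = (j == l)%:R.
    by rewrite eq_sym; case: (j == l).
  move=> <-; apply: eq_bigr => i _; rewrite !mxE.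
  have := Re_mul_conj (U i j) (U i l) 1; rewrite rmorph1 mulr1 mul1r => <-.
  by rewrite mulrC.
- move=> i; have /unitarymxP /matrixP /(_ i i) := Uunitary.
  rewrite !mxE eqxx => /(congr1 (@complex.Re R)); rewrite Re_sum.
  have -> : complex.Re (1%:R : R[i]) = 1 by [].
  move=> <-; apply: eq_bigr => j _; rewrite !mxE !expr2.
  by have := Re_mul_conj (U i j) (U i j) 1; rewrite rmorph1 mulr1 mul1r => <-.
- move=> i; have : U *m C *m invmx U = diag_mx D.
    by rewrite CE !mulmxA mulmxV // mul1mx mulmxK.
  rewrite UiE => /matrixP /(_ i i); rewrite !mxE eqxx mulr1n.
  move=> /(congr1 (@complex.Re R)); rewrite Re_sum => <-.
  rewrite exchange_big /=; apply: eq_bigr => l _.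
  rewrite !mxE mulr_suml Re_sum; apply: eq_bigr => j _.
  by rewrite !mxE Re_mul_conj.
Qed.

(** [P] is the real part of the orthogonal projection onto [k] top eigenvectors. Each [B i] is
    positive semidefinite of trace 1 and together they sum to the identity, so partial sums lie
    between 0 and 1. *)
Lemma sum_largest_contraction n (A : 'M[R]_n) k : A^T = A -> (k <= n)%N ->
  exists P : 'I_n -> 'I_n -> R,
  [/\ contraction P, \sum_i P i i = k%:R &
      sum_largest A k = \sum_i \sum_j A i j * P i j].
Proof.
move=> As kn; have [d [X [Y [chA XYc XYr AXY]]]] := symmetric_spectral As.
pose r := sort (relpre d >=%R) (enum 'I_n).
have perm_r : perm_eq r (index_enum 'I_n).
  by rewrite perm_sort /index_enum -enumT.
have sz_r : size r = n by rewrite size_sort size_enum_ord.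
have evA : eigenvalues A = map d r.
  rewrite /r -sort_map; apply: eigenvaluesE.
    by apply: sort_sorted => x y; exact: le_total.
  rewrite sort_map -/r big_map chA; apply: perm_big.
  by rewrite perm_sym.
pose B i j l := X i j * X i l + Y i j * Y i l.
exists (fun j l => \sum_(i <- take k r) B i j l); split.
- split=> [u v|x].
    by apply: eq_bigr => i _; rewrite /B; ring.
  pose Q i := (\sum_j x j * X i j) ^+ 2 + (\sum_j x j * Y i j) ^+ 2.
  have Q0 i : 0 <= Q i by rewrite addr_ge0 ?sqr_ge0.
  have QE i : \sum_j \sum_l x j * B i j l * x l = Q i.
    rewrite /Q !expr2 !mulr_suml -big_split /=; apply: eq_bigr => j _.
    rewrite !mulr_sumr -big_split /=; apply: eq_bigr => l _.
    by rewrite /B; ring.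
  have S s : \sum_j \sum_l x j * (\sum_(i <- s) B i j l) * x l =
      \sum_(i <- s) Q i.
    under [RHS]eq_bigr do rewrite -QE.
    rewrite [RHS]exchange_big; apply: eq_bigr => j _.
    rewrite [RHS]exchange_big; apply: eq_bigr => l _.
    by rewrite mulr_sumr mulr_suml.
  rewrite S sumr_ge0 //=.
  have -> : \sum_u x u ^+ 2 = \sum_(i <- r) Q i.
    rewrite -S; apply: eq_bigr => j _.
    rewrite expr2 -[X in _ * X](sum_delta x j) mulr_sumr; apply: eq_bigr => l _.
    by rewrite (perm_big _ perm_r) /= XYc mulrA.
  by rewrite -[X in _ <= \sum_(_ <- X) _](cat_take_drop k r) big_cat /= lerDl
    sumr_ge0.
- rewrite exchange_big /= (eq_bigr (fun=> 1)) => [|i _].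
    by rewrite big_const_seq count_predT size_takel ?sz_r // iter_addr_0.
  by rewrite -(XYr i); apply: eq_bigr => j _; rewrite /B !expr2.
- transitivity (\sum_(i <- take k r) d i).
    rewrite /sum_largest evA -(big_map d xpredT id) map_take.
    rewrite (big_nth 0) size_takel ?size_map ?sz_r // big_mkord.
    by apply: eq_bigr => i _; rewrite nth_take.
  under eq_bigr do rewrite -AXY.
  rewrite exchange_big; apply: eq_bigr => j _.
  rewrite exchange_big; apply: eq_bigr => l _.
  by rewrite mulr_sumr.
Qed.

End Spectral.

(** * Edge counting and the range of the subgraph density *)

Lemma handshake (G : sgraph) :
  (\sum_(x : G) \sum_(y : G) adj x y = #|edges G|.*2)%N.
Proof.
pose A := [set p : G * G | adj p.1 p.2].
pose f (p : G * G) := [set p.1; p.2].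
have -> : (\sum_(x : G) \sum_(y : G) adj x y = #|A|)%N.
  rewrite -sum1_card pair_big /= [RHS]big_mkcond; apply: eq_bigr => p _.
  by rewrite inE; case: adj.
have -> : edges G = f @: A.
  apply/setP => E; rewrite inE; apply/existsP/imsetP => [[x /existsP[y]]|[[x y]]].
    by case/andP=> xy /eqP ->; exists (x, y); rewrite ?inE.
  by rewrite inE /= => xy ->; exists x; apply/existsP; exists y; rewrite xy /=.
rewrite -sum1_card (partition_big_imset f) /= -muln2 -sum_nat_const.
apply: eq_bigr => _ /imsetP[[x y] + ->]; rewrite inE /= => xy.
have xNy : x != y by apply: contraTneq xy => ->; rewrite adj_irr.
transitivity #|[set (x, y); (y, x)]|; last first.
  by rewrite cards2 xpair_eqE negb_and xNy.
rewrite -sum1_card; apply: eq_bigl => -[a b].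
rewrite !inE /f /= !xpair_eqE; apply/andP/orP.
  case=> ab /eqP E; have aNb : a != b by apply: contraTneq ab => ->; rewrite adj_irr.
  have : a \in [set x; y] by rewrite -E !inE eqxx.
  have : b \in [set x; y] by rewrite -E !inE eqxx orbT.
  rewrite !inE => /orP[]/eqP Eb /orP[]/eqP Ea; move: aNb; rewrite Ea Eb ?eqxx //.
    by right.
  by left.
case=> /andP[/eqP -> /eqP ->]; split=> //; first by rewrite adj_sym.
by rewrite setUC.
Qed.

(** At a coordinate of largest modulus of an eigenvector, the eigenvalue is bounded by the number of
    other vertices, as the adjacency matrix has zero diagonal. *)
Lemma rho_lt (R : realType) (G : sgraph) : (0 < #|G|)%N -> rho R G < #|G|%:R.
Proof.
move=> G0; rewrite /rho; set A := adjacency R G.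
(* On an empty list the default value 0 is below [#|G|]. *)
case E: (eigenvalues A) => [|a s] /=; first by rewrite ltr0n.
have : a \in eigenvalues A by rewrite E mem_head.
rewrite mem_sort => /flatten_mapP[b].
rewrite -roots_on_rootsR ?monic_neq0 ?char_poly_monic // in_itv /= => rb.
rewrite mem_nseq => /andP[_ /eqP ->{a E}].
move: rb; rewrite -eigenvalue_root_char => /eigenvalueP[v vA v0].
have [i0 vi0] : exists i, v 0 i != 0.
  by apply/existsP; apply: contraNT v0; rewrite negb_exists => /forallP v0;
    apply/eqP/rowP => i; rewrite mxE; apply/eqP; have := v0 i; rewrite negbK.
pose i := [arg max_(i > i0) `|v 0 i|]%O.
have vi j : `|v 0 j| <= `|v 0 i|.
  by rewrite /i; case: arg_maxP => //= l _; apply.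
have vi_gt0 : 0 < `|v 0 i| by apply: lt_le_trans (vi i0); rewrite normr_gt0.
rewrite -(ltr_pM2r vi_gt0); apply: (@le_lt_trans _ _ `|(b *: v) 0 i|).
  by rewrite mxE normrM ler_wpM2r // ler_norm.
rewrite -vA mxE; apply: (@le_lt_trans _ _ (\sum_(j | j != i) `|v 0 i|)).
  rewrite (bigD1 i) //= !mxE adj_irr mulr0 add0r.
  apply: le_trans (ler_norm_sum _ _ _) _; apply: ler_sum => j _.
  rewrite mxE normrM; case: adj; rewrite /= ?normr1 ?normr0 ?mulr1 ?mulr0 //.
rewrite sumr_const -[ltLHS]mulr_natl ltr_pM2r // ltr_nat.
by rewrite (cardC1 i) card_ord prednK.
Qed.

Lemma max_subgraph_density_lt1 (R : realType) (G : sgraph) :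
  max_subgraph_density R G < 1.
Proof.
apply: (big_ind (fun x => x < 1)) => // [x y x1 y1|S S0].
  by rewrite gt_max x1.
rewrite ltr_pdivrMr ?mul1r ?ltr0n ?card_gt0 //.
have cS : #|induced S| = #|S| by rewrite card_sig.
by rewrite -[X in _ < X%:R]cS rho_lt // cS card_gt0.
Qed.

Lemma max_subgraph_density_ge0 (R : realType) (G : sgraph) :
  0 <= max_subgraph_density R G.
Proof.
rewrite /max_subgraph_density; elim/big_rec: _ => // S x _ x0.
by rewrite le_max x0 orbT.
Qed.

(** * The Laplacian trace as a defect *)

Section Laplacian.
Variables (R : realType) (G : sgraph).
Let T := 'I_#|G|.

Lemma double_bin2 k : 2 * 'C(k.+1, 2)%:R = k%:R ^+ 2 + k%:R :> R.
Proof. by rewrite -natrM -mul_bin_diag bin1 natrM /= -natr1; ring. Qed.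

Definition eadj : rel T := fun i j => adj (enum_val i) (enum_val j).

Lemma sum_enum_val (V : nmodType) (F : G -> V) :
  \sum_(i : T) F (enum_val i) = \sum_x F x.
Proof. by rewrite -big_enum_val. Qed.

Lemma sum_eadj : \sum_i \sum_j (eadj i j)%:R = 2 * #|edges G|%:R :> R.
Proof.
rewrite -natrM mul2n -handshake natr_sum -sum_enum_val; apply: eq_bigr => i _.
by rewrite natr_sum -sum_enum_val.
Qed.

Lemma laplacian_sym : (laplacian R G)^T = laplacian R G.
Proof.
apply/matrixP => i j; rewrite !mxE adj_sym; congr (_ - _).
by rewrite eq_sym; case: eqVneq => // ->.
Qed.

(** [L] is the sum of [(e_i - e_j)(e_i - e_j)^T] over the edges; the factor 2 counts ordered
    pairs. *)
Lemma trace_laplacian (P : T -> T -> R) :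
  (forall i j, P i j = P j i) ->
  (\sum_i \sum_j laplacian R G i j * P i j) *+ 2 =
  \sum_i \sum_j (eadj i j)%:R * (P i i + P j j - P i j *+ 2).
Proof.
move=> sP.
have -> : \sum_i \sum_j laplacian R G i j * P i j =
    \sum_i \sum_j (eadj i j)%:R * P i i - \sum_i \sum_j (eadj i j)%:R * P i j.
  rewrite -sumrB; apply: eq_bigr => i _.
  have -> : \sum_j (eadj i j)%:R * P i i = \sum_j
      (i == j)%:R * ((degree (enum_val i))%:R * P i j).
    rewrite sum_delta -mulr_suml; congr (_ * _).
    rewrite /degree -sum1_card natr_sum [RHS]big_mkcond -sum_enum_val.
    by apply: eq_bigr => j _; rewrite inE /eadj; case: adj.
  rewrite -sumrB; apply: eq_bigr => j _.
  by rewrite !mxE -/(eadj i j); case: eqVneq => [<-|_] /=; rewrite ?mulr1n ?mulr0n; ring.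
have E : \sum_i \sum_j (eadj i j)%:R * P i i = \sum_i \sum_j (eadj i j)%:R * P j j.
  rewrite exchange_big; apply: eq_bigr => i _; apply: eq_bigr => j _.
  by rewrite /eadj adj_sym.
rewrite mulrnBl mulr2n {2}E -sumrMnl -big_split -sumrB; apply: eq_bigr => i _.
rewrite -sumrMnl -big_split -sumrB; apply: eq_bigr => j _ /=.
ring.
Qed.

(** Twice the binomial is [k^2 + k], which spreads as [p_i p_j] over ordered pairs and [p_i] over
    vertices; on edges [p_i + p_j - 1 - p_i p_j = - q_i q_j]. *)
Lemma laplacian_defect (P : T -> T -> R) (k : nat) :
  (forall i j, P i j = P j i) -> \sum_i P i i = k%:R ->
  2 * (\sum_i \sum_j laplacian R G i j * P i j
       - (#|edges G|%:R + 'C(k.+1, 2)%:R)) = \sum_i \sum_j defect eadj P i j.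
Proof.
move=> sP trP.
have -> : \sum_i \sum_j defect eadj P i j =
    \sum_i \sum_j (eadj i j)%:R * (P i i + P j j - P i j *+ 2)
    - \sum_i \sum_j (eadj i j)%:R - \sum_i \sum_j P i i * P j j - \sum_i P i i.
  rewrite -!sumrB; apply: eq_bigr => i _.
  rewrite -[X in _ = _ - X](sum_delta (fun=> P i i) i) -!sumrB; apply: eq_bigr => j _.
  rewrite /defect; case: eqVneq => [<-|_].
    by rewrite /eadj adj_irr /=; ring.
  by case: eadj => /=; ring.
rewrite -trace_laplacian // sum_eadj.
have -> : \sum_i \sum_j P i i * P j j = k%:R ^+ 2.
  by rewrite expr2 -trP mulr_suml; apply: eq_bigr => i _; rewrite mulr_sumr.
by rewrite trP -[_ *+ 2]mulr_natl; have := double_bin2 k; lra.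
Qed.

Lemma trace_laplacian_le (P : T -> T -> R) : contraction P ->
  \sum_i \sum_j laplacian R G i j * P i j <= 2 * #|edges G|%:R.
Proof.
move=> cP; suff : (\sum_i \sum_j laplacian R G i j * P i j) *+ 2 <=
    2 * (2 * #|edges G|%:R) by rewrite -[_ *+ 2]mulr_natl; lra.
rewrite (trace_laplacian cP.1) -sum_eadj mulr_sumr; apply: ler_sum => i _.
rewrite mulr_sumr; apply: ler_sum => j _.
case: (boolP (eadj i j)) => [ij|_]; rewrite ?mul0r ?mulr0 // mul1r mulr1.
apply: contraction_pair => //; apply: contraTneq ij => ->.
by rewrite /eadj adj_irr.
Qed.

Lemma edges_le : 2 * #|edges G|%:R <= #|G|%:R ^+ 2 - #|G|%:R :> R.
Proof.
rewrite -sum_eadj.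
have row_le i : \sum_j (eadj i j)%:R <= #|G|%:R - 1 :> R.
  apply: (@le_trans _ _ (\sum_(j : T | j != i) 1)); last first.
    rewrite sumr_const (cardC1 i) card_ord.
    by rewrite -subn1 natrB // (leq_ltn_trans _ (ltn_ord i)).
  rewrite (bigD1 i) //= {1}/eadj adj_irr add0r; apply: ler_sum => j _.
  by case: eadj.
apply: le_trans (ler_sum _ (fun i _ => row_le i)) _.
by rewrite sumr_const card_ord -mulr_natl; lra.
Qed.

(** The first two bounds halve the defect estimates. The third, for small graphs, combines
    [tr (L P) <= 2 m] with [2 m <= n (n - 1)]. *)
Lemma brouwer_linear_error k : (k <= #|G|)%N ->
  let D := sum_largest (laplacian R G) k - (#|edges G|%:R + 'C(k.+1, 2)%:R) in
  [/\ D <= 9 / 4 * k%:R, D <= 13 / 4 * (#|G|%:R - k%:R) &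
      2 * D <= (#|G|%:R + k%:R) * (#|G|%:R - k%:R - 1)].
Proof.
move=> kn /=.
have [P [cP trP ->]] := sum_largest_contraction laplacian_sym kn.
have DE := laplacian_defect cP.1 trP.
have := defect_le eadj cP; have := defect_compl_le eadj cP.
rewrite -DE trP card_ord => h1 h2; split; [lra|lra|].
have := trace_laplacian_le cP; have := edges_le.
by have := double_bin2 k; lra.
Qed.

End Laplacian.


(** * Numerical comparisons and conclusion *)

Lemma sqr_error_le (R : realType) (n k : nat) (D : R) :
  (0 < n)%N -> (k <= n)%N -> 0 <= D ->
  D <= 9 / 4 * k%:R -> D <= 13 / 4 * (n%:R - k%:R) ->
  2 * D <= (n%:R + k%:R) * (n%:R - k%:R - 1) ->
  D ^+ 2 <= 2 * Num.sqrt (2 * n%:R) * (k%:R * (n%:R - k%:R)).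
Proof.
move=> n0 kn D0 D1 D2 D3; set s := Num.sqrt _.
have s0 : 0 <= s by exact: sqrtr_ge0.
have s2 : s ^+ 2 = 2 * n%:R by rewrite sqr_sqrtr // mulr_ge0.
have k0 : 0 <= k%:R :> R by [].
have j0 : 0 <= n%:R - k%:R :> R by rewrite subr_ge0 ler_nat.
have kj0 := mulr_ge0 k0 j0.
have n1 : 1 <= n%:R :> R by rewrite ler1n.
have [n6|n7] := leqP n 6.
  have {}n6 : n%:R <= 6 :> R by rewrite ler_nat.
  have s1 : 1 <= s by rewrite -ler_sqr ?nnegrE // s2; lra.
  (* [sqrt 12 < 3.465] stays below the larger root, about 3.49, of [9 (s - 1)^2 = 16 s], as [H3]
     needs. *)
  have s3 : s <= 3465 / 1000.
    by rewrite -ler_sqr ?nnegrE ?divr_ge0 // s2; lra.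
  have H1 : D ^+ 2 <= 9 / 4 * k%:R * ((n%:R + k%:R) * (n%:R - k%:R - 1) / 2).
    by rewrite expr2 ler_pM //; lra.
  (* With [j = n - k] and [n + k = s^2 - j], the two sides differ by [(s - j)^2]. *)
  have H2 : (n%:R + k%:R) * (n%:R - k%:R - 1) <= (n%:R - k%:R) * (s - 1) ^+ 2.
    have := sqr_ge0 (s - (n%:R - k%:R)).
    move: s2; nra.
  have H3 : 9 / 8 * (s - 1) ^+ 2 <= 2 * s by nra.
  have := ler_wpM2l k0 H2; have := ler_wpM2r kj0 H3; move: H1.
  by lra.
(* Here the two linear bounds suffice: [9/4 * 13/4 = 7.3125 <= 2 * 3.66], and [sqrt 14 > 3.66]. *)
have {}n7 : 7 <= n%:R :> R by rewrite ler_nat.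
have s3 : 366 / 100 <= s.
  by rewrite -ler_sqr ?nnegrE ?divr_ge0 // s2; lra.
have H1 : D ^+ 2 <= 9 / 4 * k%:R * (13 / 4 * (n%:R - k%:R)).
  by rewrite expr2 ler_pM.
have := ler_wpM2r kj0 s3; move: H1; lra.
Qed.

Lemma powR_main_sqr (R : realType) (n : nat) :
  ((2 : R) `^ (3 / 4) * n%:R `^ (1 / 4)) ^+ 2 = 2 * Num.sqrt (2 * n%:R).
Proof.
rewrite exprMn -!powR_mulrn ?powR_ge0 // -!powRrM.
have -> : 3 / 4 * 2%:R = 1 + 2^-1 :> R by field.
have -> : 1 / 4 * 2%:R = 2^-1 :> R by field.
rewrite powRD ?pnatr_eq0 ?implybT // powRr1 // !powR12_sqrt // sqrtrM //.
by rewrite mulrA.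
Qed.

Theorem theorem4p4 (R : realType) (G : sgraph) (k : nat)
    (k_gt0 : (0 < k)%N) (k_le_n : (k <= #|G|)%N) :
  [/\ sum_largest (laplacian R G) k - (#|edges G|%:R + 'C(k.+1, 2)%:R)
        <= (2 : R) `^ (3 / 4) * #|G|%:R `^ (1 / 4)
             * Num.sqrt (k%:R * (#|G|%:R - k%:R))
        <= 2 `^ (3 / 4) * #|G|%:R `^ (3 / 4) * Num.sqrt k%:R,
      sum_largest (laplacian R G) k
        <= #|edges G|%:R + 'C(k.+1, 2)%:R
           + 2 `^ (3 / 2) / Num.sqrt (1 - max_subgraph_density R G) * #|G|%:R
    & bipartite G ->
      sum_largest (laplacian R G) k
        <= #|edges G|%:R + 'C(k.+1, 2)%:R + 4 * #|G|%:R].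
Proof.
have n0 := leq_trans k_gt0 k_le_n.
have [] := brouwer_linear_error R k_le_n.
set D := _ - _ => D1 D2 D3.
have k0 : 0 <= k%:R :> R by [].
have j0 : 0 <= #|G|%:R - k%:R :> R by rewrite subr_ge0 ler_nat.
(* Weights 13/22 on [D1] and 9/22 on [D2] give [D <= 117/88 n]. *)
have D4 : D <= 2 * #|G|%:R by lra.
split; first (apply/andP; split).
- set N := _ * _ * _.
  have N0 : 0 <= N by rewrite !mulr_ge0 ?powR_ge0 ?sqrtr_ge0.
  have [D0|D0] := leP D 0; first exact: le_trans D0 N0.
  rewrite -ler_sqr ?nnegrE ?(ltW D0) // exprMn powR_main_sqr.
  by rewrite sqr_sqrtr ?mulr_ge0 // sqr_error_le // ltW.
- rewrite -!mulrA ler_wpM2l ?powR_ge0 //.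
  have -> : 3 / 4 = 1 / 4 + 2^-1 :> R by field.
  rewrite powRD ?pnatr_eq0 -?lt0n ?n0 ?implybT // powR12_sqrt // -mulrA.
  rewrite ler_wpM2l ?powR_ge0 // -sqrtrM // ler_wsqrtr // mulrC ler_wpM2r //.
  lra.
- set t := max_subgraph_density R G.
  have t1 : 0 < 1 - t by rewrite subr_gt0 max_subgraph_density_lt1.
  have t0 : 1 - t <= 1 by have := max_subgraph_density_ge0 R G; rewrite -/t; lra.
  (* By [D4] a factor of at least 2 is enough; it comes from [2^(3/2) >= 2] and
     [0 < sqrt (1 - t) <= 1]. *)
  suff : 2 * #|G|%:R <= 2 `^ (3 / 2) / Num.sqrt (1 - t) * #|G|%:R.
    by move: D4; rewrite /D; lra.
  rewrite ler_wpM2r // ler_pdivlMr ?sqrtr_gt0 //.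
  have s1 : Num.sqrt (1 - t) <= 1 by rewrite -[leRHS]sqrtr1 ler_wsqrtr.
  have p2 : 2 <= 2 `^ (3 / 2) :> R.
    by rewrite -[leLHS]powRr1 // ler_powR //; lra.
  by apply: le_trans p2; lra.
- by move=> _; move: D4; rewrite /D; have : 0 <= #|G|%:R :> R by []; lra.
Qed.
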